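(* Let $\mathcal{X}$ be a real Hilbert space, let $D\subseteq\mathcal{X}$ be a nonempty compact convex set, and let $f:\mathcal{X}\to\mathbb{R}$ be convex and differentiable over $D$ with finite curvature constant $C_f$ with respect to $D$. Let $x^*\in D$ be an optimal solution of $\min_{x\in D} f(x)$. Then for each $k\ge 1$, the iterate $x^{(k)}$ of the exact variant of the algorithm ''Greedy on a Convex Set'' satisfies $$f(x^{(k)})-f(x^* )\le \frac{4C_f}{k+2}.$$ For the approximate variant of the algorithm, it holds for each $k\ge1$ that $$f(x^{(k)})-f(x^* )\le \frac{8C_f}{k+2}.$$
   Context: Compact means closed and bounded. The inner product of $\mathcal{X}$ is $\langle\cdot,\cdot\rangle$, and $\nabla f(x)\in\mathcal{X}$ is the gradient of $f$ at $x$. Curvature constant of $f$ with respect to $D$: $$C_f:=\sup_{\substack{x,s\in D,\ \alpha\in(0,1],\\ y=x+\alpha(s-x)}}\frac{1}{\alpha^2}\bigl(f(y)-f(x)-\langle y-x,\nabla f(x)\rangle\bigr).$$ Algorithm ''Greedy on a Convex Set'': pick an arbitrary starting point $x^{(0)}\in D$. For $k=0,1,2,\dots$: let $\alpha:=\frac{2}{k+2}$; choose a point $s\in D$ as specified below; set $x^{(k+1)}:=x^{(k)}+\alpha(s-x^{(k)})$. Exact variant: $s\in D$ is any point with $\langle s,\nabla f(x^{(k)})\rangle=\min_{y\in D}\langle y,\nabla f(x^{(k)})\rangle$. Approximate variant: $s\in D$ is any point with $\langle s,\nabla f(x^{(k)})\rangle\le\min_{y\in D}\langle y,\nabla f(x^{(k)})\rangle+\alpha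 C_f$. *)

(* Defs.v *)
From HB Require Import structures.
From mathcomp Require Import all_boot all_order all_algebra.
From mathcomp Require Import all_classical all_reals all_analysis.

Set Implicit Arguments.
Unset Strict Implicit.
Unset Printing Implicit Defensive.

Import Order.TTheory GRing.Theory Num.Theory.
Import numFieldNormedType.Exports.

Local Open Scope classical_set_scope.
Local Open Scope ring_scope.

(* Together with the completeness of [X], this makes [X] with [ip] a real
   Hilbert space. *)
Definition norm_from_inner (R : realType) (X : completeNormedModType R)
    (ip : {dot X for @idfun R}) : Prop :=
  forall x : X, `|x| ^+ 2 = ip x x.

(* The Riesz representative of the Frechet differential of [f] at [x]; it is
   meaningful only where [f] is differentiable. *)
Definition gradient (R : realType) (X : completeNormedModType R)
    (ip : {dot X for @idfun R}) (f : X -> R^o) (x : X) : X :=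
  get [set g : X | forall h : X, 'd f x h = ip h g].

Definition curvature_constant (R : realType) (X : completeNormedModType R)
    (ip : {dot X for @idfun R}) (f : X -> R^o) (D : set X) : \bar R :=
  ereal_sup [set c : \bar R | exists (x s y : X) (alpha : R),
    [/\ D x, D s, 0 < alpha <= 1, y = x + alpha *: (s - x) &
        c = (1 / alpha ^+ 2 *
             (f y - f x - ip (y - x) (gradient ip f x)))%:E]].

(* Minimum over [D] of the linear functional [<., g>]. For [D] nonempty, convex,
   closed and bounded in a Hilbert space the infimum is attained. *)
Definition linear_min (R : realType) (X : completeNormedModType R)
    (ip : {dot X for @idfun R}) (D : set X) (g : X) : R :=
  inf [set ip y g | y in D].

Definition exact_choice (R : realType) (X : completeNormedModType R)
    (ip : {dot X for @idfun R}) (D : set X) (alpha : R) (g s : X) : Prop :=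
  D s /\ ip s g = linear_min ip D g.

Definition approx_choice (R : realType) (X : completeNormedModType R)
    (ip : {dot X for @idfun R}) (D : set X) (Cf : R) (alpha : R) (g s : X)
    : Prop :=
  D s /\ ip s g <= linear_min ip D g + alpha * Cf.

(* [x] is the sequence of iterates of some run of the algorithm; [choice alpha g s]
   is the rule that the point [s] selected at step size [alpha] and current
   gradient [g] has to obey. *)
Definition greedy_run (R : realType) (X : completeNormedModType R)
    (ip : {dot X for @idfun R}) (f : X -> R^o) (D : set X)
    (choice : R -> X -> X -> Prop) (x : nat -> X) : Prop :=
  D (x 0%N) /\
  forall k : nat, let alpha : R := 2 / (k + 2)%:R in
    exists2 s : X, choice alpha (gradient ip f (x k)) s &
      x k.+1 = x k + alpha *: (s - x k).

(* Main.v *)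
Require Import Defs.
From HB Require Import structures.
From mathcomp Require Import all_boot all_order all_algebra.
From mathcomp Require Import all_classical all_reals all_analysis.
From mathcomp Require Import ring lra.

(** Why the rate holds.  Let h_k be the gap between f at the k-th iterate and
    the minimum.  By definition of the curvature constant, a step of length
    alpha from x towards s costs at most
      alpha * <s - x, grad f x> + alpha^2 * Cf,
    and s almost minimises <., grad f x> over D, so s may be replaced there by
    the minimiser xstar at the price of a further alpha^2 * e (e = 0 for the
    exact rule, e = Cf for the approximate one).  Since f is convex,
    <xstar - x, grad f x> is at most -h_k: the graph lies above its tangent
    plane.  Together these give the recurrence
      h_(k+1) <= (1 - alpha) h_k + alpha^2 (Cf + e)   ([greedy_step]),
    and with alpha = 2 / (k + 2) it yields 4 (Cf + e) / (k + 2) by induction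
    ([frank_wolfe_recurrence]).

    The gradient is a chosen representative of the differential, so one has to
    know that a representative exists.  This is the Riesz theorem
    ([riesz_representation]), obtained by minimising the quadratic functional
    |x|^2 - 2 phi(x): the parallelogram law makes minimising sequences Cauchy,
    and the first-order condition at the minimiser is the representation. *)

Set Implicit Arguments.
Unset Strict Implicit.
Unset Printing Implicit Defensive.

Import Order.TTheory GRing.Theory Num.Theory.
Import numFieldNormedType.Exports.

Local Open Scope classical_set_scope.
Local Open Scope ring_scope.

(** * Riesz representation and the gradient *)

Section InnerProduct.
Variables (R : realType) (X : completeNormedModType R).
Variable ip : {dot X for @idfun R}.

Lemma ipC x y : ip x y = ip y x.
Proof. by rewrite hermC expr0 mul1r. Qed.

Lemma ipDl x y z : ip (x + y) z = ip x z + ip y z.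
Proof. exact: linearDl. Qed.

Lemma ipNl x z : ip (- x) z = - ip x z.
Proof. exact: linearNl. Qed.

Lemma ipZl a x z : ip (a *: x) z = a * ip x z.
Proof. exact: linearZl_LR. Qed.

Lemma ipDr x y z : ip z (x + y) = ip z x + ip z y.
Proof. by rewrite ipC ipDl !(ipC z). Qed.

Lemma ipZr a x z : ip z (a *: x) = a * ip z x.
Proof. by rewrite ipC ipZl (ipC z). Qed.

Lemma ipNr x z : ip z (- x) = - ip z x.
Proof. by rewrite ipC ipNl (ipC z). Qed.

Definition ipE := (ipDl, ipNl, ipZl, ipDr, ipNr, ipZr).

Hypothesis hip : norm_from_inner ip.

(** The representative is the minimiser of J x = |x|^2 - 2 phi x, which equals
    |x - g|^2 - |g|^2 once phi is known to be <., g>. *)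
Lemma riesz_representation (phi : {linear X -> R^o}) :
  continuous phi -> exists g : X, forall h : X, phi h = ip h g.
Proof.
move=> phi_cont.
have phiD x y : phi (x + y) = (phi x : R) + (phi y : R) by exact: linearD.
have phiZ a x : phi (a *: x) = a * phi x :> R by exact: linearZ.
have [M phi_bound] : exists M, forall x, `|phi x| <= M * `|x|.
  have /linear_bounded_continuous/linear_boundedP := phi_cont.
  by move=> /pinfty_ex_gt0[M _ ?]; exists M.
(* J and m enter through their properties only, as opaque quantities, so that
   the estimates below are linear arithmetic in their values. *)
have [J JE] : exists J : X -> R, forall x, J x = `|x| ^+ 2 - 2 * phi x.
  by eexists.
have [m [Jm m_approx]] : exists m : R,
    (forall x, m <= J x) /\ forall e, 0 < e -> exists x, J x < m + e.
  have J_lbound : has_lbound (range J).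
    exists (- M ^+ 2) => _ [x _ <-]; rewrite JE.
    (* J x >= |x|^2 - 2 M |x|, which is a square minus M^2 *)
    have := phi_bound x; have := ler_norm (phi x : R).
    by have := sqr_ge0 (`|x| - M); nra.
  have J_range0 : range J !=set0 by exists (J 0), 0.
  exists (inf (range J)); split=> [x|e e0].
    by apply: ge_inf => //; exists x.
  by have [_ [x _ <-] ?] := inf_adherent e0 (conj J_range0 J_lbound); exists x.
(* The parallelogram law: the terms in phi cancel because phi is linear. *)
have midpoint (u v : X) :
    `|u - v| ^+ 2 = 2 * J u + 2 * J v - 4 * J (2^-1 *: (u + v)).
  rewrite !JE !hip !ipE phiZ phiD (ipC v u).
  by field.
have /choice[u uP] : forall n : nat, exists x, J x < m + n.+1%:R^-1.
  by move=> n; apply: m_approx; rewrite invr_gt0.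
have u_cvg : cvg (u @ \oo).
  apply/cauchy_cvgP/cauchy_exP => e e0.
  (* If J exceeds m by less than e^2/4 at u and v, then, as J is at least m at
     their midpoint, the parallelogram law gives |u - v|^2 < e^2. *)
  have d0 : 0 < e ^+ 2 / 4 by rewrite divr_gt0 ?exprn_gt0.
  have [N _ NP] := near_infty_natSinv_lt (PosNum d0).
  have Ju_lt n : (N <= n)%N -> J (u n) < m + e ^+ 2 / 4.
    by move=> Nn; rewrite (lt_trans (uP n))// ltrD2l; apply: NP.
  exists (u N); exists N => // n /= Nn; rewrite -ball_normE /=.
  have := Ju_lt _ Nn; have := Ju_lt _ (leqnn N).
  have := Jm (2^-1 *: (u N + u n)).
  by rewrite -ltr_sqr ?nnegrE ?normr_ge0 ?(ltW e0)// midpoint; lra.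
have /cvg_ex[/= g ug] := u_cvg.
have Jg : J g <= m.
  have Ju : J (u n) @[n --> \oo] --> J g.
    under eq_fun do rewrite JE.
    rewrite JE; apply: cvgB.
      rewrite expr2; under eq_fun do rewrite expr2.
      by apply: cvgM; apply: cvg_norm.
    apply: cvgM; first exact: cvg_cst.
    by apply: (cvg_comp _ _ ug); apply: phi_cont.
  have mu : m + n.+1%:R^-1 @[n --> \oo] --> m.
    rewrite -[X in _ --> X]addr0; apply: cvgD; first exact: cvg_cst.
    exact: cvg_harmonic.
  by apply: (ler_cvg_to Ju mu); near=> n; apply/ltW/uP.
exists g => h.
have vary t : 0 <= 2 * t * (ip h g - phi h) + t ^+ 2 * ip h h.
  have := le_trans Jg (Jm (g + t *: h)).
  rewrite !JE !hip !ipE phiD phiZ (ipC g h); lra.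
have hh : 0 <= ip h h by rewrite -hip sqr_ge0.
(* With c the defect at h, t = - c / (|h|^2 + 1) makes the linear term
   in t beat the quadratic one unless c = 0; adding 1 covers h = 0. *)
have := vary (- (ip h g - phi h) / (ip h h + 1)).
set c := ip h g - phi h; set q := ip h h + 1.
have q0 : 0 < q by rewrite /q; lra.
rewrite (_ : _ + _ = - (c / q) ^+ 2 * (q + 1)); last first.
  by rewrite (_ : ip h h = q - 1) ?/q; [field; lra | lra].
have := sqr_ge0 (c / q) => c2 le0.
have : (c / q) ^+ 2 = 0 by nra.
move/eqP; rewrite sqrf_eq0 mulf_eq0 invr_eq0 (gt_eqF q0) orbF /c subr_eq0.
by move/eqP.
Unshelve. all: by end_near. Qed.

(** Differentiability includes continuity of the differential, so the choice
    made by [gradient] is over a nonempty set. *)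
Lemma gradientP (f : X -> R^o) (x : X) : differentiable f x ->
  forall h, 'd f x h = ip h (gradient ip f x).
Proof.
move=> df; have [g gP] := riesz_representation (diff_continuous df).
by apply: (@getPex _ [set g : X | forall h : X, 'd f x h = ip h g]); exists g.
Qed.

(** Boundedness of D is what makes the infimum a genuine lower bound: [inf]
    has a junk value on sets that are not bounded below. *)
Lemma linear_min_le (D : set X) (g y : X) :
  bounded_set D -> D y -> linear_min ip D g <= ip y g.
Proof.
move=> /pinfty_ex_gt0[M _ MP] Dy; apply: ge_inf; last by exists y.
exists (- (M ^+ 2 + ip g g)) => _ [x Dx <-].
have := MP x Dx => /= xM.
have xx : ip x x <= M ^+ 2 by rewrite -hip ler_sqr ?nnegrE// (le_trans _ xM).
have gg : 0 <= ip g g by rewrite -hip sqr_ge0.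
(* 0 <= |x + g|^2 bounds 2 <x, g> from below by - |x|^2 - |g|^2. *)
have := sqr_ge0 `|x + g|; have := sqr_ge0 `|x|.
by rewrite !hip !ipE/= (ipC g x); lra.
Qed.

End InnerProduct.

(** * Convexity along a segment *)

(** Steps of the algorithm go from x towards y, whereas the convex combination
    operator weights its first argument by t: hence the order y, x. *)
Lemma segment_conv (R : realType) (X : normedModType R) (x y : X)
    (t : {i01 R}) :
  x + t%:num *: (y - x) = conv t (y : convex_lmodType X) x.
Proof.
by rewrite [RHS]/(_ *: _ + _ *: _) scalerBl scale1r scalerBr addrCA.
Qed.

Lemma convex_set_segment (R : realType) (X : normedModType R) (D : set X)
    (x y : X) (t : R) :
  convex_set D -> D x -> D y -> 0 <= t <= 1 -> D (x + t *: (y - x)).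
Proof.
move=> D_convex Dx Dy /andP[t0 t1].
rewrite (segment_conv x y (Itv01 t0 t1)).
by apply/set_mem/D_convex; exact: mem_set.
Qed.

Lemma convex_function_segment (R : realType) (X : normedModType R) (D : set X)
    (f : X -> R^o) (x y : X) (t : R) :
  convex_function D f -> D x -> D y -> 0 <= t <= 1 ->
  f (x + t *: (y - x)) <= f x + t * (f y - f x).
Proof.
move=> f_convex Dx Dy /andP[t0 t1].
rewrite (segment_conv x y (Itv01 t0 t1)).
apply: le_trans (f_convex _ _ _ (mem_set Dy) (mem_set Dx)) _.
rewrite convRE.
(* The values of f live in [R^o], a copy of R with another structure;
   quantifying over reals brings the inequality back to R. *)
suff: forall a b : R, t * b + (1 - t) * a <= a + t * (b - a) by apply.
by move=> a b; lra.
Qed.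

(** Convexity bounds every difference quotient of f at x in the direction y - x,
    with step at most 1, by f y - f x; only the one-sided limit is available,
    since the segment need not extend beyond x inside D. *)
Lemma convex_above_tangent (R : realType) (X : normedModType R) (D : set X)
    (f : X -> R^o) (x y : X) :
  convex_function D f -> D x -> D y -> differentiable f x ->
  'd f x (y - x) <= f y - f x.
Proof.
move=> f_convex Dx Dy df; rewrite -deriveE//.
have dv : derivable f x (y - x) by exact: diff_derivable.
apply: (cvgr_to_le (cvg_dnbhs_at_right dv)); near=> h.
have h0 : 0 < h by near: h; exact: nbhs_right_gt.
have h1 : h <= 1 by near: h; exact: nbhs_right_le.
have fh : f (x + h *: (y - x)) <= f x + h * (f y - f x).
  by apply: convex_function_segment f_convex Dx Dy _; rewrite (ltW h0).
rewrite /= [h *: _ + _]addrC.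
have : forall a b c : R, a <= b + h * c -> h^-1 * (a - b) <= c.
  by move=> a b c abc; rewrite ler_pdivrMl//; lra.
by apply.
Unshelve. all: by end_near. Qed.

(** * The recurrence and its solution *)

(** The bound reproduces itself because (n + 1) / (n + 2)^2 <= 1 / (n + 3).
    The induction starts at 1: the first step has alpha = 1, which erases
    the unknown h 0. *)
Lemma frank_wolfe_recurrence (R : realType) (C : R) (h : nat -> R) :
  0 <= C ->
  (forall k : nat, let alpha := 2 / (k + 2)%:R in
     h k.+1 <= (1 - alpha) * h k + alpha ^+ 2 * C) ->
  forall k : nat, (1 <= k)%N -> h k <= 4 * C / (k + 2)%:R.
Proof.
move=> C0 hS; elim=> // -[_ _|k IH _].
  apply: le_trans (hS 0%N) _; rewrite /= divff// subrr mul0r add0r expr1n.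
  by rewrite mul1r -[(1 + 2)%N]/3%N; lra.
apply: le_trans (hS k.+1) _ => /=.
have {IH} := IH isT; rewrite !natrD -(natr1 k.+1).
have n0 : (1 : R) <= k.+1%:R by rewrite ler1n.
move: (k.+1%:R : R) n0 => n n0 IH.
have n2 : 0 < n + 2 by lra.
have n3 : 0 < n + 1 + 2 by lra.
have a1 : 0 <= 1 - 2 / (n + 2) by rewrite subr_ge0 ler_pdivrMr// mul1r; lra.
apply: le_trans (lerD (ler_wpM2l a1 IH) (lexx _)) _.
rewrite -subr_ge0 (_ : _ - _ = 4 * C / ((n + 2) ^+ 2 * (n + 1 + 2))).
  by rewrite divr_ge0 ?mulr_ge0// ltW// exprn_gt0.
by field; lra.
Qed.

(** * One step of the algorithm, and the rate *)

Section GreedyStep.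
Variables (R : realType) (X : completeNormedModType R).
Variables (ip : {dot X for @idfun R}) (D : set X) (f : X -> R^o) (Cf : R).
Hypothesis hCf : curvature_constant ip f D = Cf%:E.

Lemma curvature_bound (x s : X) (alpha : R) :
  D x -> D s -> 0 < alpha <= 1 ->
  f (x + alpha *: (s - x)) <=
    f x + alpha * ip (s - x) (gradient ip f x) + alpha ^+ 2 * Cf.
Proof.
move=> Dx Ds /andP[a0 a1]; set y := x + _.
have : ((1 / alpha ^+ 2 * (f y - f x - ip (y - x) (gradient ip f x)))%:E
         <= Cf%:E)%E.
  rewrite -hCf; apply: ereal_sup_ubound.
  by exists x, s, y, alpha; rewrite a0 a1.
rewrite lee_fin div1r ler_pdivrMl ?exprn_gt0//.
have -> : y - x = alpha *: (s - x) by rewrite /y addrC addKr.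
rewrite ipZl; lra.
Qed.

(** The value 0 is attained in the supremum by s = x. *)
Lemma curvature_constant_ge0 : D !=set0 -> 0 <= Cf.
Proof.
move=> [x Dx]; have := curvature_bound Dx Dx; move/(_ 1).
by rewrite subrr scaler0 addr0 linear0l ltr01 lexx => /(_ isT); lra.
Qed.

Hypothesis hip : norm_from_inner ip.
Hypothesis D_bounded : bounded_set D.
Hypothesis D_convex : convex_set D.
Hypothesis f_convex : convex_function D f.
Hypothesis f_diff : forall x : X, D x -> differentiable f x.

(** The error is scaled by alpha in the selection rule and by alpha again in the
    step, so it has the same order alpha^2 as the curvature term: an inexact
    choice only changes the constant. *)
Lemma greedy_step (x s z : X) (alpha e : R) :
  D x -> D s -> D z -> 0 < alpha <= 1 ->
  ip s (gradient ip f x) <= linear_min ip D (gradient ip f x) + alpha * e ->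
  f (x + alpha *: (s - x)) - f z <=
    (1 - alpha) * (f x - f z) + alpha ^+ 2 * (Cf + e).
Proof.
move=> Dx Ds Dz a01 sP.
have := curvature_bound Dx Ds a01.
have := linear_min_le hip (gradient ip f x) D_bounded Dz.
have := convex_above_tangent f_convex Dx Dz (f_diff Dx).
rewrite (gradientP hip (f_diff Dx)) !ipE => zx zmin.
set v := f (x + _).
have : alpha * (ip s (gradient ip f x) - ip x (gradient ip f x)) <=
    alpha * (f z - f x + alpha * e).
  by rewrite ler_pM2l ?(andP a01).1//; lra.
by rewrite mulrDr; lra.
Qed.

(** Treats both rules at once: each implies the displayed inequality, for its
    own value of e. *)
Lemma greedy_rate (e : R) (choice : R -> X -> X -> Prop) (x : nat -> X)
    (z : X) :
  0 <= Cf + e -> D z ->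
  (forall alpha g s, choice alpha g s ->
     D s /\ ip s g <= linear_min ip D g + alpha * e) ->
  greedy_run ip f D choice x ->
  forall k : nat, (1 <= k)%N -> f (x k) - f z <= 4 * (Cf + e) / (k + 2)%:R.
Proof.
move=> Ce0 Dz choiceP [Dx0 xS].
have a01 k : 0 < (2 / (k + 2)%:R : R) <= 1.
  by rewrite divr_gt0 ?ltr0n ?addn2//= ler_pdivrMr ?ltr0n// mul1r ler_nat.
have Dx k : D (x k).
  elim: k => // k Dxk; have [s /choiceP[Ds _] ->] := xS k.
  by apply: convex_set_segment => //; have /andP[/ltW-> ->] := a01 k.
apply: (frank_wolfe_recurrence (h := fun k => f (x k) - f z)) => //= k.
have [s /choiceP[Ds sP] ->] := xS k.
exact: greedy_step.
Qed.

End GreedyStep.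

Theorem theorem3 (R : realType) (X : completeNormedModType R)
    (ip : {dot X for @idfun R}) (hip : norm_from_inner ip)
    (D : set X) (D_nonempty : D !=set0) (D_closed : closed D)
    (D_bounded : bounded_set D) (D_convex : convex_set D)
    (f : X -> R^o) (f_convex : convex_function D f)
    (f_diff : forall x : X, D x -> differentiable f x)
    (Cf : R) (hCf : curvature_constant ip f D = Cf%:E)
    (xstar : X) (xstar_D : D xstar)
    (xstar_opt : forall y : X, D y -> f xstar <= f y) :
  (forall x : nat -> X, greedy_run ip f D (exact_choice ip D) x ->
     forall k : nat, (1 <= k)%N -> f (x k) - f xstar <= 4 * Cf / (k + 2)%:R) /\
  (forall x : nat -> X, greedy_run ip f D (approx_choice ip D Cf) x ->
     forall k : nat, (1 <= k)%N -> f (x k) - f xstar <= 8 * Cf / (k + 2)%:R).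

Proof.
have Cf0 := curvature_constant_ge0 hCf D_nonempty.
have rate e (e0 : 0 <= e) := greedy_rate hCf hip D_bounded D_convex f_convex
  f_diff (addr_ge0 Cf0 e0) xstar_D.
split=> x run k k1.
  rewrite -[Cf]addr0; apply: rate run k k1 => // alpha g s [Ds ->].
  by rewrite mulr0 addr0.
have -> : 8 * Cf = 4 * (Cf + Cf) by lra.
exact: rate run k k1.
Qed.
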